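(* Let $\Gamma$ be a finitely generated group that is infinite and virtually nilpotent, and let $\mu$ be a finitely supported, nondegenerate and symmetric probability measure on $\Gamma$. Then there exists an action of $\Gamma$ by homeomorphisms on a nonempty locally compact, $\sigma$-compact Hausdorff space $X$ that admits no nonzero $\mu$-stationary Radon measures.
   Context: A probability measure $\mu$ on $\Gamma$ is nondegenerate if its support generates $\Gamma$ as a semigroup, and symmetric if $\mu(g) = \mu(g^{-1})$ for all $g \in \Gamma$. Radon measures are non-negative, possibly infinite, Borel measures that are finite on compact sets, with the usual regularity properties (outer regular on Borel sets, inner regular on open sets). For a measure $\lambda$ on $X$ and $g \in \Gamma$, $[g\lambda](E) = \lambda(g^{-1}E)$; $\lambda$ is $\mu$-stationary if $\sum_{g \in \Gamma} \mu(g)\, g\lambda = \lambda$. *)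

(* Defs.v *)
From HB Require Import structures.
From mathcomp Require Import all_boot all_order all_algebra.
From mathcomp Require Import all_classical all_reals all_analysis.

Set Implicit Arguments.
Unset Strict Implicit.
Unset Printing Implicit Defensive.

Local Open Scope classical_set_scope.
Local Open Scope ring_scope.
Local Open Scope ereal_scope.

Definition subsemigroup (G : groupType) (S : set G) : Prop :=
  forall x y, S x -> S y -> S (x * y)%g.

Definition subgroup (G : groupType) (H : set G) : Prop :=
  [/\ H 1%g, forall x y, H x -> H y -> H (x * y)%g
    & forall x, H x -> H (x^-1)%g].

Definition semigroup_generated (G : groupType) (A : set G) : set G :=
  smallest (@subsemigroup G) A.

Definition group_generated (G : groupType) (A : set G) : set G :=
  smallest (@subgroup G) A.

Definition finitely_generated (G : groupType) : Prop :=
  exists2 A : set G, finite_set A & group_generated A = [set: G].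

Fixpoint lower_central_series (G : groupType) (H : set G) (n : nat) : set G :=
  if n is m.+1 then
    group_generated
      [set [~ x, y]%g | x in lower_central_series H m & y in H]
  else H.

Definition nilpotent_subgroup (G : groupType) (H : set G) : Prop :=
  exists n, lower_central_series H n = [set 1%g].

Definition left_cosets (G : groupType) (H : set G) : set (set G) :=
  range (fun g : G => [set (g * h)%g | h in H]).

Definition virtually_nilpotent (G : groupType) : Prop :=
  exists H : set G,
    [/\ subgroup H, finite_set (left_cosets H) & nilpotent_subgroup H].

(* [G] as a measurable space with all its subsets measurable, so that the
   probability measures on the group are the [probability (discrete_group G) R].
   The point of mass [mu(g)] is [mu [set g]]. *)
Definition discrete_group (G : groupType) : Type := G.

HB.instance Definition _ (G : groupType) := Choice.on (discrete_group G).
HB.instance Definition _ (G : groupType) :=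
  isPointed.Build (discrete_group G) (1%g : G).
HB.instance Definition _ (G : groupType) :=
  @isMeasurable.Build default_measure_display (discrete_group G)
    discrete_measurable discrete_measurable0
    discrete_measurableC discrete_measurableU.

Section measures_on_group.
Context (G : groupType) (R : realType) (mu : probability (discrete_group G) R).

Definition measure_support : set G := [set g | mu [set g] != 0].

Definition finitely_supported_measure : Prop := finite_set measure_support.

Definition nondegenerate_measure : Prop := 
  semigroup_generated measure_support = [set: G].

Definition symmetric_measure : Prop :=
  forall g : G, mu [set g] = mu [set (g^-1)%g].

End measures_on_group.

Definition homeomorphism (X Y : topologicalType) (f : X -> Y) : Prop :=
  exists f' : Y -> X,
    [/\ continuous f, continuous f', cancel f f' & cancel f' f].

Definition action_by_homeomorphisms (G : groupType) (X : topologicalType)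
    (act : G -> X -> X) : Prop :=
  [/\ forall x, act 1%g x = x,
      forall g h x, act (g * h)%g x = act g (act h x)
    & forall g, homeomorphism (act g)].

Definition sigma_compact (X : topologicalType) : Prop :=
  exists2 K : nat -> set X,
    forall n, compact (K n) & \bigcup_n K n = [set: X].

Definition borel (X : ptopologicalType) := g_sigma_algebraType (@open X).

Section measures_on_space.
Context (X : ptopologicalType) (R : realType).
Context (lambda : {measure set (borel X) -> \bar R}).

Definition finite_on_compacts : Prop :=
  forall K : set X, compact K -> lambda K < +oo.

Definition outer_regular (E : set X) : Prop :=
  lambda E = ereal_inf [set lambda U | U in [set U | open U /\ E `<=` U]].

Definition inner_regular (E : set X) : Prop :=
  lambda E = ereal_sup [set lambda K | K in [set K | compact K /\ K `<=` E]].

Definition radon_measure : Prop :=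
  [/\ finite_on_compacts,
      forall E : set (borel X), measurable E -> outer_regular E
    & forall U : set X, open U -> inner_regular U].

Definition nonzero_measure : Prop :=
  exists2 E : set (borel X), measurable E & lambda E != 0.

End measures_on_space.

Definition stationary (G : groupType) (R : realType)
    (mu : probability (discrete_group G) R) (X : ptopologicalType)
    (act : G -> X -> X) (lambda : {measure set (borel X) -> \bar R}) : Prop :=
  forall E : set (borel X), measurable E ->
    \esum_(g in [set: G]) (mu [set g] * lambda (act (g^-1)%g @` E)) = lambda E.

(* Main.v *)
Require Import Defs.
From HB Require Import structures.
From mathcomp Require Import all_boot all_order all_algebra.
From mathcomp Require Import all_classical all_reals all_analysis.

(* The space is X = G x nat, with G acting by left translation of the first
   coordinate; (gv, n) tends to (g, n+1) as v leaves finite subsets of a sparse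
   set V, so that X is countable, scattered, of rank omega.  If lambda is
   stationary and Radon then h(g) = lambda {(g, n)} is a nonnegative
   mu-harmonic function, and a compact neighbourhood of (1, n+1) contains
   (v, n) for every v in V.  Now V is the union of finite sets F_k such that
   h(1) <= \sum_(v in F_k) h(v) for every such h, whence h(1) = 0, then h = 0
   by Harnack's inequality, and lambda = 0 as X is countable.

   To get F_k, apply the maximum principle to finite sets A: some b in the outer
   boundary of A has h(b) >= h(1).  By Harnack's inequality a net of the boundary
   carries a fixed proportion of h(1), so enough such nets, far from each other,
   carry h(1).  Coarse nets make V as sparse as desired, which is what makes
   X Hausdorff and locally compact. *)

Set Implicit Arguments.
Unset Strict Implicit.
Unset Printing Implicit Defensive.
Import Order.TTheory GRing.Theory Num.Theory.

Local Open Scope classical_set_scope.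
Local Open Scope ring_scope.

(** * Harmonic functions on an infinite group *)

(** The quotient [v w^-1] is invariant under right translation, as suits functions averaged over the
    steps [g -> s g]. Asked of [(v, w)] and of [(w, v)], the condition excludes [E^-1] too. *)
Definition apart (G : groupType) (E F : seq G) :=
  forall v w, v \in F -> w \in F -> v != w -> (v * w^-1)%g \notin E.

(** Greedy choice: a point that the net does not yet cover can be added to it. *)
Lemma apart_net (G : groupType) (E L : seq G) :
  exists N, [/\ {subset N <= L}, apart E N &
    forall b, b \in L -> exists e v,
      [/\ e \in 1%g :: E ++ [seq (x^-1)%g | x <- E], v \in N & b = (e * v)%g]].
Proof.
elim: L => [|b L [N [NL sepN coverN]]]; first by exists [::]; split.
have [/hasP[v vN bv]|/hasPn far] := boolP (has (fun v =>
    (b * v^-1)%g \in 1%g :: E ++ [seq (x^-1)%g | x <- E]) N).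
  exists N; split=> // [x /NL xL|x]; first by rewrite inE xL orbT.
  rewrite inE => /predU1P[->|/coverN//].
  by exists (b * v^-1)%g, v; rewrite mulgVK.
exists (b :: N); split.
- move=> x; rewrite !inE => /predU1P[->|/NL ->]; first by rewrite eqxx.
  by rewrite orbT.
- move=> v w; rewrite !inE => /predU1P[->|vN] /predU1P[->|wN] neq.
  + by rewrite eqxx in neq.
  + by move: (far _ wN); rewrite inE mem_cat !negb_or => /and3P[].
  + move: (far _ vN); rewrite inE mem_cat !negb_or => /and3P[_ _].
    by apply: contra => vbE; apply/mapP; exists (v * b^-1)%g; rewrite ?invgF.
  + exact: sepN.
- move=> x; rewrite inE => /predU1P[->|/coverN[e [v [eE vN ->]]]].
    by exists 1%g, b; rewrite mul1g !inE !eqxx.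
  by exists e, v; split=> //; rewrite inE vN orbT.
Qed.

Section harmonic.
Context (R : realType) (G : groupType) (S : seq G) (p : G -> R).

(** Stationarity at a point has the terms [mu(s) h(s^-1 g)], so [S] will consist of the inverses of
    the support. *)
Definition harmonic_fun (h : G -> R) :=
  (forall g, 0 <= h g) /\ forall g, h g = \sum_(s <- S) p s * h (s * g)%g.

Hypothesis p_gt0 : forall s, s \in S -> 0 < p s.
Hypothesis p_sum1 : \sum_(s <- S) p s = 1.
Hypothesis S_gen : forall T : set G, subsemigroup T ->
  (forall s, s \in S -> T s) -> forall g, T g.
Hypothesis G_inf : forall L : seq G, exists g, g \notin L.

Lemma harmonic_step h s g : harmonic_fun h -> s \in S -> p s * h (s * g)%g <= h g.
Proof.
move=> [h0 hE] sS; rewrite [leRHS]hE (big_rem s)//= lerDl.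
rewrite big_seq sumr_ge0// => t /mem_rem tS.
by rewrite mulr_ge0// ltW// p_gt0.
Qed.

(** The [t] that admit a constant form a subsemigroup containing [S], as constants multiply. *)
Lemma harnack t : exists2 c, 0 < c &
  forall h g, harmonic_fun h -> c * h (t * g)%g <= h g.
Proof.
apply: (S_gen (T := fun t => exists2 c, 0 < c &
  forall h g, harmonic_fun h -> c * h (t * g)%g <= h g)) => {t}.
  move=> x y [c c0 hc] [d d0 hd]; exists (c * d); first exact: mulr_gt0.
  move=> h g hh; rewrite -mulgA (mulrC c) -mulrA.
  by apply: le_trans (hd _ g hh); rewrite ler_pM2l// hc.
by move=> s sS; exists (p s) => [|h g hh]; [exact: p_gt0|exact: harmonic_step].
Qed.

Lemma harnack_seq (E : seq G) : exists2 c, 0 < c &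
  forall e h g, e \in E -> harmonic_fun h -> c * h (e * g)%g <= h g.
Proof.
elim: E => [|t E [c c0 hc]]; first by exists 1.
have [d d0 hd] := harnack t.
exists (Num.min c d) => [|e h g]; first by rewrite lt_min c0.
rewrite inE => /predU1P[->|eE] hh.
  by apply: le_trans (hd _ g hh); rewrite ler_wpM2r ?hh.1// ge_min lexx orbT.
by apply: le_trans (hc _ _ g eE hh); rewrite ler_wpM2r ?hh.1// ge_min lexx.
Qed.

Lemma harmonic_eq0 h : harmonic_fun h -> h 1%g = 0 -> forall g, h g = 0.
Proof.
move=> hh h1 g; have [c c0 /(_ h 1%g hh)] := harnack g.
rewrite mulg1 h1 pmulr_rle0// => hg.
by apply/eqP; rewrite eq_le hg hh.1.
Qed.

Definition boundary (A : seq G) :=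
  [seq x <- [seq (s * a)%g | s <- S, a <- A] | x \notin A].

(** Otherwise the maximum of [h] on [A] exceeds all boundary values; by averaging, the neighbours of
    a maximum point lie in [A] and are maximal again, so the finite [A] would exhaust [G]. *)
Lemma maximum_principle (A : seq G) h : 1%g \in A -> harmonic_fun h ->
  exists2 b, b \in boundary A & h 1%g <= h b.
Proof.
move=> A1 [h0 hE]; have [a aA amax] : exists2 a, a \in A &
    forall x, x \in A -> h x <= h a.
  move: A1; elim: A 1%g => // y A IH x.
  have [->|[z zA]] : A = [::] \/ exists z, z \in A.
  - by case: A {IH} => [|z A]; [left|right; exists z; rewrite mem_head].
  - by rewrite inE => /eqP <-; exists x; rewrite ?inE// => ?; rewrite inE => /eqP ->.
  have [a aA amax] := IH z zA; move=> _.
  have [hya|hay] := leP (h y) (h a).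
    exists a; first by rewrite inE aA orbT.
    by move=> w; rewrite inE => /predU1P[->//|/amax].
  exists y; first exact: mem_head.
  by move=> w; rewrite inE => /predU1P[->//|/amax/le_trans]; apply; exact: ltW.
apply: contrapT => noB.
have lt_bd b : b \in boundary A -> h b < h a.
  move=> bA; apply: lt_le_trans (amax _ A1).
  by rewrite ltNge; apply/negP => hb; apply: noB; exists b.
have step s g : s \in S -> g \in A -> h g = h a ->
    (s * g)%g \in A /\ h (s * g)%g = h a.
  move=> sS gA hga.
  have le_a t : t \in S -> h (t * g)%g <= h a.
    move=> tS; have [/amax//|tgA] := boolP ((t * g)%g \in A).
    by rewrite ltW// lt_bd// mem_filter tgA allpairs_f.
  (* These deficits are nonnegative and average to zero, so each vanishes. *)
  have : \sum_(t <- S | t \in S) p t * (h a - h (t * g)%g) == 0.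
    rewrite -big_seq; under eq_bigr do rewrite mulrBr.
    by rewrite sumrB -mulr_suml p_sum1 mul1r -hE hga subrr.
  rewrite psumr_eq0 => [/allP/(_ s sS)|t tS]; last first.
    by rewrite mulr_ge0 ?subr_ge0 ?le_a// ltW// p_gt0.
  rewrite sS /= mulf_eq0 gt_eqF ?p_gt0//= subr_eq0 => /eqP hsg.
  split=> //; apply: contraT => sgA.
  by have := lt_bd (s * g)%g; rewrite mem_filter sgA allpairs_f// hsg ltxx => /(_ isT).
have [g /negP[]] := G_inf A.
have := S_gen (T := fun t => forall g, g \in A -> h g = h a ->
  (t * g)%g \in A /\ h (t * g)%g = h a).
move=> /(_ _ _ (g * a^-1)%g a aA erefl)[].
- by move=> x y Tx Ty z zA hz; rewrite -mulgA; have [/Tx] := Ty _ zA hz; apply.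
- by move=> s sS z; exact: step.
by rewrite mulgVK.
Qed.

(** The boundary point given by the maximum principle depends on [h], but a net of the boundary has
    a point near it, to which Harnack's inequality applies. As [c] does not depend on [A], the step
    can be iterated. *)
Lemma spread_once (E : seq G) : exists2 c, 0 < c & forall A : seq G,
  exists F : seq G, [/\ uniq F, forall v, v \in F -> v \notin A, apart E F &
    forall h, harmonic_fun h -> c * h 1%g <= \sum_(v <- F) h v].
Proof.
have [c c0 hc] := harnack_seq (1%g :: E ++ [seq (x^-1)%g | x <- E]).
exists c => // A.
have [N [NL sepN coverN]] := apart_net E (boundary (1%g :: A)).
exists (undup N); split; first exact: undup_uniq.
- move=> v; rewrite mem_undup => /NL; rewrite mem_filter inE negb_or.
  by move=> /andP[/andP[]].
- by move=> v w; rewrite !mem_undup; exact: sepN.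
move=> h hh; have [b] := maximum_principle (mem_head 1%g A) hh.
move=> /coverN[e [v [eE vN ->]]] h1.
apply: (@le_trans _ _ (h v)).
  by apply: le_trans (hc e h v eE hh); rewrite ler_pM2l.
rewrite (big_rem v) ?mem_undup//= lerDl sumr_ge0// => x _; exact: hh.1.
Qed.

Lemma spread (E : seq G) : exists F : seq G,
  [/\ uniq F, forall v, v \in F -> v \notin E, apart E F &
    forall h, harmonic_fun h -> h 1%g <= \sum_(v <- F) h v].
Proof.
have [c c0 once] := spread_once E.
suff iter n : exists F : seq G,
    [/\ uniq F, forall v, v \in F -> v \notin E, apart E F &
    forall h, harmonic_fun h -> n%:R * c * h 1%g <= \sum_(v <- F) h v].
  (* The number of rounds exceeds [1/c]. *)
  have [F [F1 F2 F3 F4]] := iter (Num.truncn c^-1).+1.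
  exists F; split=> // h hh; apply: le_trans (F4 h hh).
  rewrite ler_peMl ?hh.1// -ler_pdivrMr// mul1r ltW//.
  by rewrite truncnS_gt.
elim: n => [|n [F [uF FE sF hF]]].
  by exists [::]; split=> // h hh; rewrite big_nil mul0r mul0r.
(* Avoiding [F] and its translates by [E] and [E^-1] keeps the union duplicate-free and apart. *)
have [N [uN NA sN hN]] := once (E ++ F ++
  [seq (e * v)%g | e <- E ++ [seq (x^-1)%g | x <- E], v <- F]).
have far v w : v \in N -> w \in F ->
    (v * w^-1)%g \notin E ++ [seq (x^-1)%g | x <- E].
  move=> vN wF; have /[!mem_cat] /norP[_ /norP[_]] := NA _ vN.
  apply: contra; rewrite -mem_cat => vwE; apply/allpairsP.
  by exists ((v * w^-1)%g, w); split=> //=; rewrite mulgVK.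
exists (N ++ F); split.
- rewrite cat_uniq uN uF andbT; apply/hasPn => v vF; apply/negP => /NA.
  by rewrite !mem_cat vF orbT.
- move=> v; rewrite mem_cat => /orP[/NA|/FE//].
  by rewrite mem_cat negb_or => /andP[].
- move=> v w; rewrite !mem_cat => /orP[vN|vF] /orP[wN|wF].
  + exact: sN.
  + by move=> _; have := far _ _ vN wF; rewrite mem_cat negb_or => /andP[].
  + move=> _; have := far _ _ wN vF; rewrite mem_cat negb_or => /andP[_].
    by apply: contra => vwE; apply/mapP; exists (v * w^-1)%g; rewrite ?invgF.
  + exact: sF.
move=> h hh; rewrite big_cat/= -natr1 mulrDl mul1r mulrDl addrC.
by rewrite lerD ?hF ?hN.
Qed.

End harmonic.

(** * Products of sparse elements *)

(* [F k] is the set of elements of rank [k], [P k] contains the products of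
   elements of increasing ranks below [k], and the finite sets [B k] exhaust [G]. *)
Record sparse_tower (G : groupType) (B F P : nat -> seq G) : Prop := {
  exhaust_homo : {homo B : j k / (j <= k)%N >-> {subset j <= k}};
  exhaust_inv : forall k b, b \in B k -> (b^-1)%g \in B k;
  exhaust1 : forall k, 1%g \in B k;
  exhaust_cover : forall g, exists k, g \in B k;
  prods1 : 1%g \in P 0%N;
  prods_sub : forall k, {subset P k <= P k.+1};
  prodsM : forall k p v, p \in P k -> v \in F k -> (p * v)%g \in P k.+1;
  sparse_uniq : forall k, uniq (F k);
  sparse_notin : forall k p b q v, p \in P k -> b \in B k -> q \in P k ->
    v \in F k -> v <> (p^-1 * b * q)%g;
  sparse_sep : forall k p b q v w, p \in P k -> b \in B k -> q \in P k ->
    v \in F k -> w \in F k -> (v * w^-1)%g = (p^-1 * b * q)%g -> v = w }.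

Section chains.
Context (G : groupType) (F : nat -> seq G).

Fixpoint chain (lo hi j : nat) : set G :=
  if j is j'.+1 then
    [set w | exists k v w', [/\ (lo <= k < hi)%N, v \in F k,
                                chain k.+1 hi j' w' & w = (v * w')%g]]
  else [set 1%g].

Lemma chain_widen lo lo' hi hi' j : (lo' <= lo)%N -> (hi <= hi')%N ->
  chain lo hi j `<=` chain lo' hi' j.
Proof.
elim: j lo lo' => [|j IH] lo lo' lo_le hi_le //= w.
move=> [k [v [w' [/andP[lok khi] vF cw' ->]]]].
exists k, v, w'; split=> //; last exact: IH cw'.
by rewrite (leq_trans lo_le)// (leq_trans khi).
Qed.

Lemma chain_cat lo mid hi i j a w : (mid <= hi)%N ->
  chain lo mid i a -> chain mid hi j w -> (lo <= mid)%N ->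
  chain lo hi (i + j) (a * w)%g.
Proof.
move=> midhi; elim: i lo a => [|i IH] lo a /=.
  by move=> -> cw lomid; rewrite mul1g; exact: chain_widen cw.
move=> [k [v [a' [/andP[lok kmid] vF ca ->]]]] cw _.
exists k, v, (a' * w)%g; rewrite lok (leq_trans kmid) ?mulgA//.
by split=> //; exact: IH.
Qed.

(** [chain] peels off the factor of smallest rank; the avoidance conditions concern the one of
    largest rank. *)
Lemma chain_last lo hi j w : chain lo hi j.+1 w ->
  exists k v w', [/\ (lo <= k < hi)%N, v \in F k,
                     chain lo k j w' & w = (w' * v)%g].
Proof.
elim: j lo w => [|j IH] lo w [k [v [w' [klohi vF cw' ->]]]].
  by exists k, v, 1%g; rewrite cw' mulg1 mul1g.
have [l [u [z [/andP[kl lhi] uF cz ->]]]] := IH _ _ cw'.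
move: klohi => /andP[lok _].
exists l, u, (v * z)%g; split=> //; last by rewrite mulgA.
  by rewrite lhi (leq_trans lok)// ltnW.
by exists k, v, z; rewrite lok.
Qed.

End chains.

(** * Cancellation in products of sparse elements, and cones *)

Section cancellation.
Context (G : groupType) (B F P : nat -> seq G).
Hypothesis tower : sparse_tower B F P.

Lemma prods_homo : {homo P : j k / (j <= k)%N >-> {subset j <= k}}.
Proof.
move=> j k /subnK <-; elim: (k - j)%N => // d IH x /IH.
exact: prods_sub tower _ _.
Qed.

Lemma prods_one k : 1%g \in P k.
Proof. exact: prods_homo (leq0n k) _ (prods1 tower). Qed.

Lemma chain_prods k j w : chain F 0 k j w -> w \in P k.
Proof.
elim: j k w => [|j IH] k w; first by move=> ->; exact: prods_one.
move=> /chain_last[l [v [w' [/andP[_ lk] vF /IH w'P ->]]]].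
exact: prods_homo lk _ (prodsM tower w'P vF).
Qed.

(* Compare the last factors of the two products: unless they coincide, the one
   of larger rank lies in the finite set that it was chosen to avoid. *)
Lemma chain_cancel a M hi hi' i j w : a \in B M ->
  chain F M hi j w -> chain F 0 hi' (i + j) (a * w)%g ->
  exists hi'', chain F 0 hi'' i a.
Proof.
move=> aB; elim: j hi hi' w => [|j IH] hi hi' w.
  by move=> ->; rewrite addn0 mulg1 => ca; exists hi'.
move=> /chain_last[k [v [w' [/andP[Mk _] vF cw' ->]]]]; rewrite addnS.
move=> /chain_last[l [u [u' [_ uF cu' awu]]]].
have cw0 : chain F 0 k j w' by exact: chain_widen cw'.
(* The ranks in [w] are at least [M], so [a] is taken into account at each of them. *)
have aBk n : (M <= n)%N -> a \in B n.
  by move=> Mn; exact: exhaust_homo tower _ _ Mn _ aB.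
have uE : u = (u'^-1 * a * (w' * v))%g by rewrite -mulgA awu mulKg.
have vE : v = (w'^-1 * a^-1 * (u' * u))%g by rewrite -awu !mulgA mulgVK mulVg mul1g.
have [kl|lk|kl] := ltngtP k l.
- case: (sparse_notin tower (chain_prods cu') (aBk _ _) _ uF uE).
    exact: leq_trans Mk (ltnW kl).
  exact: prods_homo kl _ (prodsM tower (chain_prods cw0) vF).
- case: (sparse_notin tower (chain_prods cw0) (exhaust_inv tower (aBk _ Mk)) _ vF vE).
  exact: prods_homo lk _ (prodsM tower (chain_prods cu') uF).
(* At equal ranks [v u^-1] is an excluded quotient, so [v = u] and this factor cancels. *)
- move: uF cu'; rewrite -kl => uF cu'.
  have vu : v = u.
    apply: (sparse_sep tower (chain_prods cw0) (exhaust_inv tower (aBk _ Mk))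
      (chain_prods cu') vF uF).
    by rewrite {1}vE !mulgA mulgK.
  apply: (IH k k w' cw'); rewrite (_ : (a * w')%g = u')//.
  by apply: (mulIg v); rewrite -mulgA awu vu.
Qed.

Lemma sparse_sub_prods k : {subset F k <= P k.+1}.
Proof.
move=> v vF; rewrite -(mul1g v); apply: (prodsM tower) => //; exact: prods_one.
Qed.

(* The compact open neighbourhood of [i]: the points [(i.1 * v_1 ... v_j, i.2 - j)]
   with [v_1, ..., v_j] of increasing ranks. *)
Definition cone (i : G * nat) : set (G * nat) :=
  [set x | (x.2 <= i.2)%N /\
    exists hi, chain F 0 hi (i.2 - x.2) (i.1^-1 * x.1)%g].

Lemma cone_refl i : cone i i.
Proof. by split=> //; exists 0%N; rewrite subnn /= mulVg. Qed.

Lemma cone_same g h n : cone (g, n) (h, n) -> h = g.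
Proof. by move=> [_ [hi]] /=; rewrite subnn => /= /mulg1_eq; rewrite invgK. Qed.

Lemma cone_translate g i x : cone ((g * i.1)%g, i.2) ((g * x.1)%g, x.2) = cone i x.
Proof. by rewrite /cone/= invgM -mulgA mulKg. Qed.

Lemma cone_child k v g n : v \in F k -> cone (g, n.+1) ((g * v)%g, n).
Proof.
move=> vF; split=> //=; exists k.+1; rewrite subSnn mulKg.
by exists k, v, 1%g; rewrite mulg1/=; split.
Qed.

(** At level 0 the predecessor is 0 again; the condition [z.2 < x.2] used below discards these
    spurious children. *)
Definition children M (x : G * nat) : seq (G * nat) :=
  [seq ((x.1 * v)%g, x.2.-1) | v <- flatten [seq F k | k <- iota 0 M]].

(** Split on the rank of the first factor: if it is at least [M], so are all later ones. *)
Lemma cone_descend M x y : cone x y -> y <> x ->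
  (exists2 z, z \in children M x /\ (z.2 < x.2)%N & cone z y) \/
  exists w hi, [/\ y.1 = (x.1 * w)%g, (y.2 <= x.2)%N & chain F M hi (x.2 - y.2) w].
Proof.
case: x y => [g m] [h n] [/= nm [hi]].
case mn : (m - n)%N => [|j].
  move=> /= /mulg1_eq; rewrite invgK => -> [].
  by congr pair; apply/eqP; rewrite eqn_leq nm -subn_eq0 mn.
move=> /= [k [v [w [khi vF cw wE]]]] _.
have hE : h = (g * (v * w))%g by rewrite -wE mulVKg.
have [kM|Mk] := ltnP k M; last first.
  right; exists (v * w)%g, hi; split=> //.
  by exists k, v, w; rewrite Mk khi.
have m0 : (0 < m)%N by rewrite (leq_trans _ (leq_subr n m))// mn.
left; exists ((g * v)%g, m.-1).
  split; last by rewrite /= prednK.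
  apply/mapP; exists v => //; apply/flattenP; exists (F k) => //.
  by rewrite map_f// mem_iota.
split=> /=; first by rewrite -ltnS prednK// -subn_gt0 mn.
exists hi; rewrite hE !mulgA invgM -!mulgA mulKg mulKg.
have -> : (m.-1 - n)%N = j by rewrite -subn1 subnAC mn subn1.
exact: chain_widen cw.
Qed.

(* Up to finitely many cones of lower level, [cone x] is either contained in
   [cone i] or disjoint from it, according to whether [x] lies in [cone i]. *)
Lemma cone_almost x i : exists M,
  (cone i x /\
   cone x `<=` cone i `|` [set y | exists2 z,
     z \in children M x /\ (z.2 < x.2)%N & cone z y]) \/
  (~ cone i x /\
   ((x.2 <= i.2)%N -> cone x `&` cone i `<=` [set y | exists2 z,
     z \in children M x /\ (z.2 < x.2)%N & cone z y])).
Proof.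
(* Here [M] bounds the ranks on the way from [i] to [x], so products with ranks from [M] on extend
   it. *)
case: i => [h m]; have [[/= xm [M ca]]|nix] := pselect (cone (h, m) x).
  exists M; left; split; first by split=> //; exists M.
  move=> y xy; have [->|/eqP yx] := eqVneq y x.
    by left; split=> //; exists M.
  have [|[w [hi [yE yx2 cw]]]] := cone_descend M xy yx; first by right.
  left; split=> /=; first exact: leq_trans xm.
  exists (maxn M hi); rewrite yE mulgA.
  have -> : (m - y.2 = (m - x.2) + (x.2 - y.2))%N by rewrite addnBA// subnK.
  apply: (chain_cat (leq_maxl M hi) ca _ (leq0n M)).
  exact: chain_widen (leqnn M) (leq_maxr M hi) _ cw.
(* With this [M], [chain_cancel] shows that a common point reached from [x] by ranks from [M] on
   would put [x] in the cone of [i]. *)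
have [M aB] := exhaust_cover tower (h^-1 * x.1)%g.
exists M; right; split=> // xm y [xy [/= ym [hi' cy]]].
have [yx|/eqP yx] := eqVneq y x.
  by case: nix; rewrite -yx; split=> //; exists hi'.
have [//|[w [hi [yE yx2 cw]]]] := cone_descend M xy yx.
case: nix; split=> //=; apply: (chain_cancel (hi' := hi') aB cw).
rewrite -mulgA -yE.
by have <- : (m - y.2 = (m - x.2) + (x.2 - y.2))%N by rewrite addnBA// subnK.
Qed.

Fixpoint sparse_seq N : seq G := if N is n.+1 then sparse_seq n ++ F n else [::].

Lemma sparse_seq_prods N : {subset sparse_seq N <= P N}.
Proof.
elim: N => // N IH x; rewrite mem_cat => /orP[/IH/(prods_sub tower)//|].
exact: sparse_sub_prods.
Qed.

(** [F N] avoids [P N], which contains all elements of smaller rank. *)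
Lemma sparse_seq_uniq N : uniq (sparse_seq N).
Proof.
elim: N => //= N IH; rewrite cat_uniq IH (sparse_uniq tower) andbT.
apply/hasPn => v vF; apply/negP => /sparse_seq_prods vP.
apply: (sparse_notin tower (prods_one N) (exhaust1 tower N) vP vF).
by rewrite invg1 !mul1g.
Qed.

Lemma sparse_seq_cone N v n : v \in sparse_seq N -> cone (1%g, n.+1) (v, n).
Proof.
elim: N => // N IH; rewrite mem_cat => /orP[/IH//|vF].
by rewrite -[v]mul1g; exact: cone_child vF.
Qed.

End cancellation.

(** * The space *)

(* [T] with the coarsest topology in which all the [U i] are clopen. *)
Definition clopen_space (T : pointedType) (I : eqType) (U : I -> set T) : Type := T.

Section clopen_space.
Context (T : pointedType) (I : eqType) (U : I -> set T).
Local Notation X := (clopen_space U).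

Definition clopen_open : set_system T := [set A | forall x, A x ->
  exists L : seq I, forall y, (forall i, i \in L -> U i x <-> U i y) -> A y].

Lemma clopen_openT : clopen_open setT.
Proof. by move=> x _; exists [::]. Qed.

Lemma clopen_openI (A B : set T) :
  clopen_open A -> clopen_open B -> clopen_open (A `&` B).
Proof.
move=> oA oB x [/oA[K hK] /oB[L hL]]; exists (K ++ L) => y xy.
by split; [apply: hK|apply: hL] => i iL; apply: xy; rewrite mem_cat iL ?orbT.
Qed.

Lemma clopen_open_bigU (J : Type) (f : J -> set T) :
  (forall j, clopen_open (f j)) -> clopen_open (\bigcup_j f j).
Proof.
by move=> of_ x [j _ /of_[L hL]]; exists L => y /hL; exists j.
Qed.

HB.instance Definition _ := Pointed.on X.
HB.instance Definition _ :=
  isOpenTopological.Build X clopen_openT clopen_openI clopen_open_bigU.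

Lemma open_sub i : open (U i : set X).
Proof.
by move=> x Ux; exists [:: i] => y /(_ i); rewrite mem_head => /(_ isT) <-.
Qed.

Lemma open_subC i : open (~` U i : set X).
Proof.
by move=> x nUx; exists [:: i] => y /(_ i); rewrite mem_head /= => /(_ isT) <-.
Qed.

Lemma clopen_space_cvg (F : set_system X) (x : X) : Filter F ->
  (forall i, U i x -> F (U i)) -> (forall i, ~ U i x -> F (~` U i)) -> F --> x.
Proof.
move=> FF FU FUC A; rewrite nbhsE => -[B [oB Bx] BA].
have [L hL] := oB x Bx; apply: filterS BA _; apply: filterS hL _.
elim: L => [|i L IH]; first exact: filterE.
have : F [set y | U i x <-> U i y].
  have [Uix|nUix] := pselect (U i x).
    by apply: filterS (FU _ Uix) => y.
  by apply: filterS (FUC _ nUix) => y.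
move=> /(filterI IH); apply: filterS => y [yL yi] j.
by rewrite inE => /predU1P[->//|/yL].
Qed.

(** Continuity is tested on the [U i] and their complements. *)
Lemma clopen_space_homeo (f f' : X -> X) (s s' : I -> I) :
  cancel f f' -> cancel f' f ->
  (forall i, f @^-1` U i = U (s i)) -> (forall i, f' @^-1` U i = U (s' i)) ->
  homeomorphism f.
Proof.
have cont (g : X -> X) (t : I -> I) :
    (forall i, g @^-1` U i = U (t i)) -> continuous g.
  move=> gU x; apply: clopen_space_cvg => [|i Ui|i nUi].
  - by apply: fmap_filter; exact: nbhs_filter.
  - rewrite /fmap/= gU; apply: open_nbhs_nbhs; split; first exact: open_sub.
    by rewrite -gU.
  - change (nbhs x (~` (g @^-1` U i))); rewrite gU; apply: open_nbhs_nbhs.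
    by split; [exact: open_subC|rewrite -gU].
by move=> fK f'K fU f'U; exists f'; split=> //; [exact: cont fU|exact: cont f'U].
Qed.

Lemma clopen_space_hausdorff :
  (forall x y, (forall i, U i x <-> U i y) -> x = y) -> hausdorff_space X.
Proof.
move=> sep x y xy; apply: sep => i; split=> [Ux|Uy]; apply: contrapT => nU.
- have [z [zU nzU]] := xy _ _ (open_nbhs_nbhs (conj (@open_sub i) Ux))
    (open_nbhs_nbhs (conj (@open_subC i) nU)).
  exact: nzU.
- have [z [nzU zU]] := xy _ _ (open_nbhs_nbhs (conj (@open_subC i) nU))
    (open_nbhs_nbhs (conj (@open_sub i) Uy)).
  exact: nzU.
Qed.

End clopen_space.

Lemma ultra_has (T : Type) (I : eqType) (F : set_system T) (U : I -> set T)
    (L : seq I) :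
  UltraFilter F -> F [set x | exists2 i, i \in L & U i x] ->
  exists2 i, i \in L & F (U i).
Proof.
move=> FU; elim: L => [|i L IH] FL.
  by have /filter_ex[x [i]] := FL.
have [Fi|Fi] := in_ultra_setVsetC (U i) FU; first by exists i; rewrite ?mem_head.
have [|j jL Fj] := IH; last by exists j; rewrite // inE jL orbT.
apply: filterS (filterI FL Fi) => x [[j]].
by rewrite inE => /predU1P[->//|jL Uj _]; exists j.
Qed.

(** * Topology of the tower space *)

Section tower_space.
Context (G : groupType) (B F P : nat -> seq G).
Hypothesis tower : sparse_tower B F P.

Definition tower_carrier : Type := (G * nat)%type.
HB.instance Definition _ := Choice.on tower_carrier.
HB.instance Definition _ := isPointed.Build tower_carrier (1%g : G, 0%N).

Definition tower_space : ptopologicalType :=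
  clopen_space (cone F : G * nat -> set tower_carrier).

Definition translate (g : G) (x : tower_space) : tower_space := ((g * x.1)%g, x.2).

Lemma translate_action : action_by_homeomorphisms translate.
Proof.
have cancelV g : cancel (translate g) (translate (g^-1)%g).
  by case=> h n; rewrite /translate/= mulKg.
split=> [[h n]|g k [h n]|g]; rewrite /translate/= ?mul1g ?mulgA//.
have preim k i : translate k @^-1` cone F i = cone F (translate (k^-1)%g i).
  by apply/seteqP; split=> x /=; rewrite -(cone_translate F k (translate k^-1 i) x)
    /translate/= mulVKg; case: i.
apply: (clopen_space_homeo (cancelV g) _ (preim g) (preim (g^-1)%g)).
by move=> x; rewrite -{1}(invgK g) cancelV.
Qed.

(** Cones separate points: two points in each other's cones have the same level, hence differ by an
    empty product. *)
Lemma tower_hausdorff : hausdorff_space tower_space.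
Proof.
apply: clopen_space_hausdorff => -[g n] [h m] gh.
have [_] := gh (g, n) => _; have := (gh (g, n)).1 (cone_refl F _).
have := (gh (h, m)).2 (cone_refl F _) => /[dup] -[/= nm _] ghm /[dup] -[/= mn _].
have mnE : m = n by apply/eqP; rewrite eqn_leq nm mn.
by rewrite mnE => /cone_same ->.
Qed.

(* An ultrafilter containing a cone converges to the vertex of a cone of minimal
   level in it. *)
Lemma cone_compact i : compact (cone F i : set tower_space).
Proof.
rewrite compact_ultra => Fi FU Fcone.
pose has_cone m := `[< exists g, Fi (cone F (g, m)) >].
have ex_m : exists m, has_cone m.
  by exists i.2; apply/asboolP; exists i.1; case: i Fcone.
case: (ex_minnP ex_m) => m /asboolP[g Fgm] mmin.
have low j : (j.2 < m)%N -> ~ Fi (cone F j).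
  by move=> jm Fj; have := mmin j.2; rewrite leqNgt jm => /(_ _)/negP[]//;
    apply/asboolP; exists j.1; case: j {jm} Fj.
(* The children are finitely many and of level below the minimum. *)
have nochild M : ~ Fi [set y | exists2 z, z \in children F M (g, m) /\
    (z.2 < m)%N & cone F z y].
  move=> Fch.
  have [|z] := @ultra_has _ _ Fi (cone F)
      [seq z <- children F M (g, m) | (z.2 < m)%N] FU.
    by apply: filterS Fch => y [z [zc zm] zy]; exists z; rewrite // mem_filter zm.
  by rewrite mem_filter => /andP[/low].
(* By [cone_almost], up to children the cone of [(g, m)] lies inside or outside that of [j], so [Fi]
   sides with [(g, m)]. *)
have inE j : cone F j (g, m) -> Fi (cone F j).
  have [M [[_ gj]|[]//]] := cone_almost tower (g, m) j => _.
  have [//|nFj] := in_ultra_setVsetC (cone F j) FU.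
  case: (nochild M); apply: filterS (filterI Fgm nFj) => y [/gj[]//].
have outE j : ~ cone F j (g, m) -> Fi (~` cone F j).
  have [M [[]//|[_ gj]]] := cone_almost tower (g, m) j => _.
  have [Fj|//] := in_ultra_setVsetC (cone F j) FU.
  have [/gj sub|/low//] := leqP m j.2.
  by case: (nochild M); apply: filterS (filterI Fgm Fj).
exists (g, m); split; last exact: clopen_space_cvg.
apply: contrapT => /outE nFi; apply: (@filter_not_empty _ Fi).
  by rewrite -(setICr (cone F i)); exact: filterI.
Qed.

Lemma tower_locally_compact : locally_compact [set: tower_space].
Proof.
move=> x _; exists (cone F x).
  rewrite withinET; apply: open_nbhs_nbhs; split; first exact: open_sub.
  exact: cone_refl.
by split; [exact: cone_compact|apply: compact_closed;
  [exact: tower_hausdorff|exact: cone_compact]].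
Qed.

(** These finite sets exhaust the space: they give sigma-compactness, and later reduce null sets to
    null points. *)
Definition tower_stage (n : nat) : set tower_space :=
  [set x | x.1 \in B n /\ (x.2 <= n)%N].

Lemma tower_stage_finite n : finite_set (tower_stage n).
Proof.
apply: (sub_finite_set _ (finite_setX (finite_seq (B n)) (finite_II n.+1))).
by move=> [g k] [/= gB kn].
Qed.

Lemma bigcup_tower_stage : \bigcup_n tower_stage n = [set: tower_space].
Proof.
apply/seteqP; split=> // -[g k] _; have [n gB] := exhaust_cover tower g.
exists (maxn n k) => //; split=> /=; last exact: leq_maxr.
exact: exhaust_homo tower _ _ (leq_maxl n k) _ gB.
Qed.

Lemma tower_sigma_compact : sigma_compact tower_space.
Proof.
exists tower_stage; last exact: bigcup_tower_stage.
by move=> n; apply: finite_compact; exact: tower_stage_finite.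
Qed.

End tower_space.

(** * Construction of the sparse sets *)

Section exhaustion.
Context (G : groupType) (S : seq G).

Fixpoint words (k : nat) : seq G :=
  if k is k'.+1 then words k' ++ [seq (s * w)%g | s <- S, w <- words k']
  else [:: 1%g].

(** Inverses are adjoined because the cancellation argument uses [a^-1] along with [a]. *)
Definition sym_words k := words k ++ [seq (w^-1)%g | w <- words k].

Lemma words_homo : {homo words : j k / (j <= k)%N >-> {subset j <= k}}.
Proof.
move=> j k /subnK <-; elim: (k - j)%N => // d IH x /IH xw.
by rewrite addSn /= mem_cat xw.
Qed.

Lemma sym_words_homo : {homo sym_words : j k / (j <= k)%N >-> {subset j <= k}}.
Proof.
move=> j k jk x; rewrite !mem_cat => /orP[/(words_homo jk) ->//|].
by move=> /mapP[w /(words_homo jk) wk ->]; rewrite (map_f (fun w => w^-1)%g wk) orbT.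
Qed.

Lemma sym_words_inv k b : b \in sym_words k -> (b^-1)%g \in sym_words k.
Proof.
rewrite !mem_cat => /orP[bw|/mapP[w wk ->]]; last by rewrite invgK wk.
by rewrite (map_f (fun w => w^-1)%g bw) orbT.
Qed.

Lemma sym_words1 k : 1%g \in sym_words k.
Proof. by rewrite mem_cat (words_homo (leq0n k)) ?mem_head. Qed.

Hypothesis S_gen : forall T : set G, subsemigroup T ->
  (forall s, s \in S -> T s) -> forall g, T g.

Lemma sym_words_cover g : exists k, g \in sym_words k.
Proof.
suff [k gk] : exists k, g \in words k by exists k; rewrite mem_cat gk.
(* Multiplying words by [t] on the left, rather than being a word, is visibly closed under
   products. *)
have := S_gen (T := fun t => forall k w, w \in words k ->
  exists j, (t * w)%g \in words j).
move=> /(_ _ _ g 0%N 1%g (mem_head _ _))[].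
- move=> x y Tx Ty k w /Ty[j /Tx[i]]; rewrite mulgA; by exists i.
- by move=> s sS k w wk; exists k.+1; rewrite mem_cat allpairs_f ?orbT.
- by move=> j; rewrite mulg1; exists j.
Qed.

Context (f : seq G -> seq G).
Hypothesis f_uniq : forall E, uniq (f E).
Hypothesis f_notin : forall E v, v \in f E -> v \notin E.
Hypothesis f_sep : forall E, apart E (f E).

(** One list serves twice: [f] keeps both its elements and their quotients out of it, giving
    [sparse_notin] and [sparse_sep]. *)
Definition avoid k (P : seq G) :=
  [seq (x * q)%g | x <- [seq (p^-1 * b)%g | p <- P, b <- sym_words k], q <- P].

Fixpoint prods (k : nat) : seq G :=
  if k is k'.+1 then
    prods k' ++ [seq (p * v)%g | p <- prods k', v <- f (avoid k' (prods k'))]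
  else [:: 1%g].

Definition sparse k := f (avoid k (prods k)).

Lemma sparse_towerP : sparse_tower sym_words sparse prods.
Proof.
have avoidP k p b q : p \in prods k -> b \in sym_words k -> q \in prods k ->
    (p^-1 * b * q)%g \in avoid k (prods k).
  by move=> pP bB qP; apply: allpairs_f => //; apply: (allpairs_f (fun p b => p^-1 * b)%g).
split.
- exact: sym_words_homo.
- exact: sym_words_inv.
- exact: sym_words1.
- exact: sym_words_cover.
- exact: mem_head.
- by move=> k x; rewrite mem_cat => ->.
- by move=> k p v pP vF; rewrite mem_cat (allpairs_f _ pP vF) orbT.
- by move=> k; exact: f_uniq.
- move=> k p b q v pP bB qP /f_notin vE vpbq.
  by move: vE; rewrite vpbq avoidP.
- move=> k p b q v w pP bB qP vF wF vw; apply/eqP; apply: contraT => /(f_sep vF wF).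
  by rewrite vw avoidP.
Qed.

End exhaustion.

(** * Stationary measures *)

Section null_sets.
Context d (T : measurableType d) (R : realType) (lam : {measure set T -> \bar R}).
Hypothesis point_measurable : forall x : T, measurable [set x].

Lemma measure_finite_set (D : set T) : finite_set D ->
  lam D = (\sum_(x \in D) lam [set x])%E.
Proof.
move=> finD; rewrite -(measure_fin_bigcup _ finD) ?bigcup_imset1 ?image_id//.
by move=> x y _ _ [z [-> ->]].
Qed.

(** Used both for [mu] off its support and for the stationary measure. *)
Lemma null_points (D : nat -> set T) (E : set T) :
  (forall n, finite_set (D n)) -> E `<=` \bigcup_n D n -> measurable E ->
  (forall x, E x -> lam [set x] = 0%E) -> lam E = 0%E.
Proof.
move=> finD ED mE null; apply: measure_negligible => //.
apply: (@negligibleS _ _ _ _ (\bigcup_n (E `&` D n))).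
  by move=> x Ex; have [n _ Dnx] := ED x Ex; exists n.
apply: negligible_bigcup => n.
have finED : finite_set (E `&` D n) by exact: finite_setIr.
exists (E `&` D n); split=> //.
  rewrite -[X in measurable X]image_id -bigcup_imset1.
  exact: fin_bigcup_measurable.
by rewrite measure_finite_set// fsbig1// => x [Ex _]; exact: null.
Qed.

End null_sets.

Section borel.
Context (X : ptopologicalType).

Lemma borel_open (U : set X) : open U -> measurable (U : set (borel X)).
Proof. by move=> oU; exact: sub_sigma_algebra. Qed.

Lemma borel_set1 : hausdorff_space X -> forall x : borel X, measurable [set x].
Proof.
move=> hX x; rewrite -[X in measurable X]setCK; apply: measurableC.
apply: borel_open; apply: closed_openC; apply: compact_closed => //.
exact: compact_set1.
Qed.

End borel.

Lemma stationary_point (R : realType) (G : groupType)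
    (mu : probability (discrete_group G) R) (X : ptopologicalType)
    (act : G -> X -> X) (lam : {measure set (borel X) -> \bar R})
    (L : seq G) (x : borel X) :
  stationary mu act lam -> measurable [set x] -> uniq L ->
  measure_support mu = [set` L] ->
  lam [set x] = (\sum_(s <- L) mu [set s] * lam [set act (s^-1)%g x])%E.
Proof.
move=> st mx uL suppL.
have finS : finite_set (measure_support mu).
  by rewrite suppL; exact: finite_seq.
rewrite -(st _ mx) fsbig_seq// -suppL -esum_fset//; last first.
  by move=> s _; rewrite mule_ge0.
rewrite [RHS]esum_mkcond; apply: eq_esum => s _.
rewrite image_set1; case: ifPn => // /negP sS.
suff -> : mu [set s] = 0%E by rewrite mul0e.
by apply/eqP; apply: contrapT => /negP mus; apply: sS; rewrite inE.
Qed.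

(** * Point masses at a fixed level *)

Section tower_measure.
Context (R : realType) (G : groupType) (S : seq G) (p : G -> R).
Context (B F P : nat -> seq G).
Hypothesis tower : sparse_tower B F P.
Hypothesis F_sum : forall k h, harmonic_fun S p h -> h 1%g <= \sum_(v <- F k) h v.
Context (lam : {measure set (borel (tower_space F)) -> \bar R}).
Hypothesis lam_finite : finite_on_compacts lam.

Lemma tower_point_measurable (x : borel (tower_space F)) : measurable [set x].
Proof. exact: borel_set1 (@tower_hausdorff _ F) x. Qed.

(** Points are compact, so their mass is finite and [fine] loses nothing. *)
Definition level_mass n (g : G) : R := fine (lam [set ((g, n) : tower_space F)]).

Lemma level_massE n g : lam [set ((g, n) : tower_space F)] = (level_mass n g)%:E.
Proof. by rewrite fineK// ge0_fin_numE// lam_finite//; exact: compact_set1. Qed.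

Lemma level_mass_le n N :
  (\sum_(v <- sparse_seq F N) (level_mass n v)%:E <=
   lam (cone F (1%g, n.+1)))%E.
Proof.
pose D : set (tower_space F) := \bigcup_(v in [set` sparse_seq F N]) [set (v, n)].
have mpoint v : measurable [set ((v, n) : borel (tower_space F))].
  exact: tower_point_measurable.
have mD : measurable (D : set (borel (tower_space F))).
  by apply: fin_bigcup_measurable => // v _; exact: mpoint.
have lamD : lam D = (\sum_(v <- sparse_seq F N) (level_mass n v)%:E)%E.
  rewrite (@measure_fin_bigcup _ _ _ lam _ [set` sparse_seq F N]
    (fun v => [set ((v, n) : borel (tower_space F))]) (finite_seq _)) => [|//|//].
    rewrite -fsbig_seq ?(sparse_seq_uniq tower)//; apply: eq_bigr => v _.
    exact: level_massE.
  by move=> v w _ _ [z [-> []]].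
rewrite -lamD; apply: le_measure; rewrite ?inE//.
  by apply: borel_open; exact: open_sub.
by move=> _ [v vN ->]; exact: sparse_seq_cone vN.
Qed.

(** Each [F k] contributes at least [h(1)] to the finite mass of one compact cone, for infinitely
    many disjoint [F k]. *)
Lemma level_mass1 n : harmonic_fun S p (level_mass n) -> level_mass n 1%g = 0.
Proof.
move=> hh; apply/eqP; rewrite eq_le hh.1 andbT leNgt; apply/negP => h1.
have ge N : N%:R * level_mass n 1%g <= \sum_(v <- sparse_seq F N) level_mass n v.
  elim: N => [|N IH]; first by rewrite mul0r big_nil.
  by rewrite big_cat/= -natr1 mulrDl mul1r lerD// F_sum.
have fin : (lam (cone F (1%g, n.+1)) < +oo)%E.
  by apply: lam_finite; exact: cone_compact tower _.
pose c := fine (lam (cone F (1%g, n.+1))).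
have cE : lam (cone F (1%g, n.+1)) = c%:E by rewrite fineK// ge0_fin_numE.
have le N : N%:R * level_mass n 1%g <= c.
  by apply: le_trans (ge N) _; rewrite -lee_fin -sumEFin -cE level_mass_le.
have := le (Num.truncn (c / level_mass n 1%g)).+1.
by rewrite leNgt -ltr_pdivrMr// truncnS_gt.
Qed.

End tower_measure.

Theorem proposition1p3 (R : realType) (G : groupType)
    (mu : probability (discrete_group G) R) :
  finitely_generated G ->
  infinite_set [set: G] ->
  virtually_nilpotent G ->
  finitely_supported_measure mu ->
  nondegenerate_measure mu ->
  symmetric_measure mu ->
  exists (X : ptopologicalType) (act : G -> X -> X),
    [/\ action_by_homeomorphisms act,
        locally_compact [set: X],
        sigma_compact X,
        hausdorff_space X
      & ~ exists lambda : {measure set (borel X) -> \bar R},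
          [/\ radon_measure lambda,
              stationary mu act lambda
            & nonzero_measure lambda]].
Proof.
move=> _ infG _ /finite_seqP[L0 suppL0] gen sym.
pose L := undup L0.
have suppL : measure_support mu = [set` L].
  by rewrite suppL0; apply/seteqP; split=> x /=; rewrite mem_undup.
have suppLE x : (x \in L) = (mu [set x] != 0%E).
  by apply/idP/idP => [xL|mux]; have : measure_support mu x <-> [set` L] x
    by [rewrite suppL]; move=> [h1 h2]; [exact: h2|exact: h1].
(* The action enters stationarity through [s^-1], hence the inverses here and in [p]. *)
pose S := [seq (s^-1)%g | s <- L].
pose p s := fine (mu [set (s^-1)%g]).
have muE s : mu [set s] = (p (s^-1)%g)%:E.
  by rewrite /p invgK fineK// fin_num_measure.
have SL s : s \in S -> (s^-1)%g \in L by move=> /mapP[t tL ->]; rewrite invgK.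
have p_gt0 s : s \in S -> 0 < p s.
  move=> /SL; rewrite suppLE -lte_fin -[s in p s]invgK -muE => mus.
  by rewrite lt_neqAle eq_sym mus measure_ge0.
(* By symmetry of [mu], [S] contains the support, which generates. *)
have S_gen (T : set G) : subsemigroup T -> (forall s, s \in S -> T s) -> forall g, T g.
  move=> subT ST g; have : semigroup_generated (measure_support mu) g by rewrite gen.
  apply: smallest_sub => // s; rewrite /measure_support/= sym => mus.
  apply: ST; apply/mapP; exists (s^-1)%g; last by rewrite invgK.
  by rewrite suppLE.
have G_inf (A : seq G) : exists g, g \notin A.
  apply: contrapT => all; apply: infG; apply: (sub_finite_set _ (finite_seq A)).
  by move=> g _ /=; apply: contrapT => /negP gA; apply: all; exists g.
have p_sum1 : \sum_(s <- S) p s = 1.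
  rewrite /S big_map.
  have point (x : discrete_group G) : measurable [set x] by [].
  have finL : finite_set [set` L] by exact: finite_seq.
  have : mu [set: discrete_group G] = 1%E by exact: probability_setT.
  rewrite -(setUv [set` L]) measureU//; last exact: setICr.
  (* [G] is exhausted by the finite [sym_words S n], so the complement of the support is null. *)
  rewrite [X in (_ + X)%E](null_points point (D := fun n => [set` sym_words S n])) //=.
  - rewrite adde0 (measure_finite_set _ point finL) -fsbig_seq ?undup_uniq//.
    rewrite (eq_bigr (fun s => (p (s^-1)%g)%:E)) => [|s _]; last exact: muE.
    by rewrite sumEFin => -[].
  - by move=> x _; have [n xn] := sym_words_cover S_gen x; exists n.
  - by move=> x /negP; rewrite suppLE negbK => /eqP.
have /choice[f fP] : forall E : seq G, exists F : seq G,
    [/\ uniq F, forall v, v \in F -> v \notin E, apart E F &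
    forall h, harmonic_fun S p h -> h 1%g <= \sum_(v <- F) h v].
  by move=> E; exact: spread.
pose F := sparse S f.
have tower : sparse_tower (sym_words S) F (prods S f).
  by apply: sparse_towerP => // E; have [] := fP E.
have F_sum k h : harmonic_fun S p h -> h 1%g <= \sum_(v <- F k) h v.
  by have [_ _ _] := fP (avoid S k (prods S f k)); apply.
exists (tower_space F), (@translate _ F); split.
- exact: translate_action.
- exact: tower_locally_compact tower.
- exact: tower_sigma_compact tower.
- exact: tower_hausdorff.
move=> [lam [[lam_fin _ _] st [E mE /negP[]]]]; apply/eqP.
have harm n : harmonic_fun S p (level_mass lam n).
  split=> [g|g]; first exact: fine_ge0.
  apply: EFin_inj; rewrite -(level_massE lam_fin).
  rewrite (stationary_point st _ (undup_uniq L0) suppL); last first.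
    exact: tower_point_measurable.
  rewrite /S big_map -sumEFin; apply: eq_bigr => s _.
  by rewrite muE EFinM -level_massE.
(* The space is countable, so it remains to see that points are null. *)
apply: (null_points (@tower_point_measurable _ F)
  (@tower_stage_finite _ (sym_words S) F)) => //.
  by rewrite (bigcup_tower_stage tower).
move=> [g n] _; rewrite (level_massE lam_fin).
by rewrite (harmonic_eq0 p_gt0 S_gen (harm n))// (level_mass1 tower F_sum lam_fin).
Qed.
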